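(* Let $n\ge 1$, let $I^{n}=\prod_{i=1}^{n}[a_{i},b_{i}]\subset\mathbb{R}^{n}$ with $a_i<b_i$ for all $i$, and let $f=(f_{1},\dots,f_{n}):I^{n}\to\mathbb{R}^{n}$ be a continuous map such that for every $i=1,\dots,n$ and all $x_j\in[a_j,b_j]$ ($j\neq i$), $$f_{i}(x_{1},\dots,x_{i-1},a_{i},x_{i+1},\dots,x_{n})\cdot f_{i}(x_{1},\dots,x_{i-1},b_{i},x_{i+1},\dots,x_{n})<0 .$$ Then there is at least one point $x\in I^{n}$ with $f(x)=0$.
   Context: No special definitions are needed. *)

(* Defs.v *)
From mathcomp Require Import all_boot all_order all_algebra.
From mathcomp Require Import all_classical all_reals all_analysis.
Set Implicit Arguments.
Unset Strict Implicit.
Unset Printing Implicit Defensive.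
Import Order.TTheory GRing.Theory Num.Theory.
Import numFieldNormedType.Exports.
Local Open Scope classical_set_scope.
Local Open Scope ring_scope.

Definition box (R : realType) (n : nat) (a b : 'rV[R]_n) : set 'rV[R]_n :=
  [set x | forall i : 'I_n, a ord0 i <= x ord0 i <= b ord0 i].

(* (x_1, ..., x_(i-1), c, x_(i+1), ..., x_n) *)
Definition set_coord (R : realType) (n : nat) (x : 'rV[R]_n) (i : 'I_n)
    (c : R) : 'rV[R]_n :=
  \row_(j < n) (if j == i then c else x ord0 j).

(* Main.v *)
Require Import Defs.
From mathcomp Require Import all_boot all_order all_algebra.
From mathcomp Require Import all_classical all_reals all_analysis.
From mathcomp Require Import fingroup perm zify ring lra.
Set Implicit Arguments.
Unset Strict Implicit.
Unset Printing Implicit Defensive.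
Import Order.TTheory GRing.Theory Num.Theory.
Import numFieldNormedType.Exports.
Local Open Scope classical_set_scope.
Local Open Scope ring_scope.

(** Along each face [x_i = a_i] (resp. [x_i = b_i]) the function [f_i] has no
    zero, and a face is convex, so [f_i] has a constant sign on it; by hypothesis
    the signs on opposite faces differ.  Multiplying [f_i] by one of its values
    on the face [x_i = b_i] gives [g_i < 0] on the face [x_i = a_i], [g_i > 0] on
    the opposite one, and the same zeros as [f_i] ([mainTheorem1] from
    [signed_miranda]).

    Cut the box into [N^n] cells and record, at each grid point [v], the bits
    [e_i v], which say whether [g_i] is positive there.  The combinatorial core
    ([discrete_miranda]) is that in some cell every bit [e_i] changes along a
    single monotone path from the lowest corner to the highest one.  As [N]
    grows, such cells accumulate at a point of the compact box, at which each
    [g_i] can be neither positive nor negative ([signed_miranda]).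

    The combinatorial statement is a degree computation, over the integers, on
    the Freudenthal triangulation of the grid, whose top simplices are the
    monotone paths [v_0, ..., v_n] crossing a cell and are indexed by the cell
    and a permutation giving the order of the steps.  Let [T e] be the sum over
    all simplices, with the sign of the permutation, of
      [\prod_i (e_i (v_(i+1)) - e_i (v_i))],
    that is, the cup product [de_0 de_1 ... de_m] evaluated on the grid.
    If [T e != 0], some product is nonzero, which is the claim.  Stokes' formula
    shows that [T e] depends only on the behaviour of the bits on the boundary:
    replacing one [e_i] by another function with the same values on its two faces
    changes [T e] by the integral of [de_0 ... d(delta) ... de_m], where [delta]
    vanishes on these faces, hence by a sum over boundary simplices which is zero
    ([alt_sum_closed]).  So the [e_i] may be replaced by the bits [0 < v_i], for
    which exactly one product is nonzero and [T = 1]. *)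

(** * Alternating sums over the Freudenthal triangulation of a grid *)

Definition vertex (m : nat) := {ffun 'I_m.+1 -> nat}.

(** The coordinate [i] is the one increased at step [p i]: storing the position of
    each coordinate, rather than the coordinate moved at each step, makes the
    path explicit without any summation. *)
Definition chain (m K : nat) (x : {ffun 'I_m.+1 -> 'I_K.+1}) (p : 'S_m.+1)
    (k : nat) : vertex m := [ffun i => (x i + (p i < k))%N].

Definition alt_sum (m K : nat) (F : (nat -> vertex m) -> int) : int :=
  \sum_(p : 'S_m.+1) (-1) ^+ p *
    \sum_(x : {ffun 'I_m.+1 -> 'I_K.+1}) F (chain x p).

Lemma alt_sumB (m K : nat) (F G : (nat -> vertex m) -> int) :
  alt_sum K (fun v => F v - G v) = alt_sum K F - alt_sum K G.
Proof.
rewrite /alt_sum -sumrB; apply: eq_bigr => p _.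
by rewrite -mulrBr -sumrB.
Qed.

Lemma alt_sumD (m K : nat) (F G : (nat -> vertex m) -> int) :
  alt_sum K (fun v => F v + G v) = alt_sum K F + alt_sum K G.
Proof.
rewrite /alt_sum -big_split; apply: eq_bigr => p _ /=.
by rewrite -mulrDr -big_split.
Qed.

Lemma eq_alt_sum (m K : nat) (F G : (nat -> vertex m) -> int) :
  (forall (x : {ffun 'I_m.+1 -> 'I_K.+1}) p, F (chain x p) = G (chain x p)) ->
  alt_sum K F = alt_sum K G.
Proof.
by move=> FG; apply: eq_bigr => p _; congr (_ * _); apply: eq_bigr => x _.
Qed.

(** Facets in the interior of a cell cancel: exchanging the steps before and after
    the vertex [v_(k+1)] changes no other vertex of the path and reverses the sign
    of the permutation. *)
Lemma alt_sum_skip (m K k : nat) (F : (nat -> vertex m) -> int) :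
  (k < m)%N ->
  (forall v w, (forall t, t != k.+1 -> v t = w t) -> F v = F w) ->
  alt_sum K F = 0.
Proof.
move=> km Fk.
pose s : 'S_m.+1 := tperm (inord k) (inord k.+1).
have vs (j : 'I_m.+1) : nat_of_ord (s j) =
    if j == k :> nat then k.+1 else if j == k.+1 :> nat then k else j :> nat.
  have ik : (inord k : 'I_m.+1) = k :> nat by rewrite inordK; lia.
  have ik1 : (inord k.+1 : 'I_m.+1) = k.+1 :> nat by rewrite inordK; lia.
  rewrite /s; case: tpermP => [->|->|/eqP + /eqP].
  - by rewrite ik1 ik eqxx.
  - by rewrite ik1 ik eqxx eqn_leq ltnn.
  - by rewrite -!val_eqE /= ik ik1 => /negPf-> /negPf->.
suff : alt_sum K F = - alt_sum K F by lia.
rewrite {1}/alt_sum (reindex_inj (@mulIg _ s)) -sumrN; apply: eq_bigr => p _.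
have -> : odd_perm (p * s)%g = ~~ p.
  by rewrite odd_permM odd_tperm -val_eqE /= !inordK ?eqn_leq ?ltnn ?andbF ?addbT // ltnW.
rewrite signrN mulNr; congr (- (_ * _)).
apply: eq_bigr => x _; apply: Fk => t tk; apply/ffunP => i; rewrite !ffunE.
congr (_ + nat_of_bool _)%N; rewrite permM vs; move: tk.
by move: (nat_of_ord (p i)) => a /eqP tk; case: (a =P k); last case: (a =P k.+1); lia.
Qed.

(** Facets orthogonal to an axis cancel between neighbouring cells.  Dropping
    [v_0] from a path whose first step is along [c] leaves the facet obtained by
    dropping the last vertex from the path of the next cell in direction [c] that
    makes the same steps cyclically shifted, so that the step along [c] comes last.
    A cyclic shift of [m + 1] steps has sign [(-1) ^+ m].  The two vanishing
    hypotheses deal with the facets on the boundary of the grid, which have no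
    neighbour. *)
Lemma alt_sum_rotate (m K : nat) (F G : (nat -> vertex m) -> int) :
  (forall v w, (forall t, (t <= m)%N -> v t.+1 = w t) -> F v = G w) ->
  (forall (v : nat -> vertex m) c, (forall t : nat, (t <= m)%N -> v t.+1 c = K.+1) -> F v = 0) ->
  (forall (v : nat -> vertex m) c, (forall t : nat, (t <= m)%N -> v t c = 0%N) -> G v = 0) ->
  alt_sum K F = (-1) ^+ m * alt_sum K G.
Proof.
move=> FG F0 G0.
(* r i = i - 1, and r 0 = m *)
pose r : 'S_m.+1 := lift_perm ord0 ord_max 1.
have r0 : r ord0 = ord_max by rewrite lift_perm_id.
have rS (i : 'I_m) : nat_of_ord (r (lift ord0 i)) = i.
  by rewrite lift_perm_lift perm1 lift_max.
have sgnr : (-1) ^+ r = (-1) ^+ m :> int.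
  by rewrite odd_lift_perm odd_perm1 /= addbF signr_odd.
rewrite [in RHS]/alt_sum (reindex_inj (@mulIg _ r)) mulr_sumr.
apply: eq_bigr => p _.
rewrite odd_permM signr_addb sgnr mulrA mulrCA -expr2 sqrr_sign mulr1.
congr (_ * _).
pose c : 'I_m.+1 := (p^-1)%g ord0.
have pc : p c = ord0 by rewrite /c permKV.
(* Shifting cyclically makes the reindexing a bijection; the cells that wrap
   around are those where both summands vanish. *)
pose sh (x : {ffun 'I_m.+1 -> 'I_K.+1}) : {ffun 'I_m.+1 -> 'I_K.+1} :=
  [ffun i => if i == c then ordS (x i) else x i].
have sh_inj : injective sh.
  move=> x y /ffunP e; apply/ffunP => i; move: (e i); rewrite !ffunE.
  by case: eqP => // _; exact: ordS_inj.
rewrite [RHS](reindex_inj sh_inj); apply: eq_bigr => x _.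
have [xc|xc] := eqVneq (nat_of_ord (x c)) K.
  rewrite (F0 _ c) ?(G0 _ c) // => t tm; rewrite !ffunE ?eqxx /=.
    by rewrite permM pc r0 /= xc modnn; lia.
  by rewrite pc /= xc; lia.
apply: FG => t tm; apply/ffunP => i; rewrite !ffunE permM.
have [->|ic] := eqVneq i c.
  rewrite pc r0 /= modn_small.
    by rewrite (leq_gtF tm) addn1 addn0.
  by rewrite ltn_neqAle eqSS xc ltn_ord.
have [j ->|pi0] := unliftP ord0 (p i); first by rewrite rS /=.
by case/eqP: ic; apply: (@perm_inj _ p); rewrite pc.
Qed.

(** The product of the increments of [m] functions along the steps of a path with
    [m + 1] steps, taken in order, the step [k] being left out. *)
Definition gap_prod (m : nat) (h : 'I_m -> vertex m -> int) (k : nat)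
    (v : nat -> vertex m) : int :=
  \prod_(t < m) (h t (v (bump k t).+1) - h t (v (bump k t))).

(** Only the function number [k] takes another step when the gap moves from [k] to
    [k + 1]; the sum of its two increments is its increment from [v_k] to
    [v_(k+2)], so that the vertex [v_(k+1)] does not occur in the sum of the two
    products. *)
Lemma alt_sum_gapS (m K : nat) (h : 'I_m -> vertex m -> int)
    (d : vertex m -> int) (k q : nat) :
  (k < m)%N -> q != k.+1 ->
  alt_sum K (fun v => d (v q) * gap_prod h k.+1 v) =
  - alt_sum K (fun v => d (v q) * gap_prod h k v).
Proof.
move=> km qk; apply/eqP; rewrite -addr_eq0 -alt_sumD; apply/eqP.
apply: (alt_sum_skip K km) => v w vw; rewrite vw //; rewrite -!mulrDr; congr (_ * _).
pose i := Ordinal km.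
have gapE u : gap_prod h k.+1 u + gap_prod h k u =
    (h i (u k.+2) - h i (u k)) *
    \prod_(t < m | t != i) (h t (u (bump k t).+1) - h t (u (bump k t))).
  rewrite /gap_prod (bigD1 i) //= [X in _ + X = _](bigD1 i) //=.
  rewrite [X in _ * X + _](_ : _ = \prod_(t < m | t != i)
       (h t (u (bump k t).+1) - h t (u (bump k t)))); last first.
    apply: eq_bigr => t; rewrite -val_eqE /= => tk.
    by rewrite (_ : bump k.+1 t = bump k t) // /bump; lia.
  have -> : bump k.+1 k = k by rewrite /bump; lia.
  have -> : bump k k = k.+1 by rewrite /bump; lia.
  by ring.
rewrite !gapE !vw; try lia; congr (_ * _); apply: eq_bigr => t.
by rewrite -val_eqE /= => tk; rewrite !vw // /bump; lia.
Qed.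

Lemma alt_sum_gap (m K : nat) (h : 'I_m -> vertex m -> int)
    (d : vertex m -> int) (k q l : nat) :
  (k + l <= m)%N -> (q <= k)%N || (k + l < q)%N ->
  alt_sum K (fun v => d (v q) * gap_prod h (k + l) v) =
  (-1) ^+ l * alt_sum K (fun v => d (v q) * gap_prod h k v).
Proof.
elim: l => [|l IH] klm qkl; first by rewrite addn0 mul1r.
by rewrite addnS alt_sum_gapS ?IH ?exprS ?mulN1r ?mulNr //; lia.
Qed.

(** The cup product of the coboundaries of the [e j], on the simplex [v]. *)
Definition coboundary_prod (m : nat) (e : 'I_m.+1 -> vertex m -> int)
    (v : nat -> vertex m) : int :=
  \prod_(j < m.+1) (e j (v j.+1) - e j (v j)).

Definition bit_bdry (m K : nat) (e : 'I_m.+1 -> vertex m -> int) : Prop :=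
  forall j (v : vertex m), (v j = 0%N -> e j v = 0) /\ (v j = K.+1 -> e j v = 1).

(** Stokes' formula for [d(delta)] inserted at position [i] among the [dh_t].  The
    two sides are moved, by shifting the gap, to the facets without the first and
    without the last vertex of the path; these agree by [alt_sum_rotate].  A facet
    on the face [v_c = 0] or [v_c = K + 1] contributes nothing since, on that face,
    [d] vanishes if [c = i] and otherwise the [h_t] attached to [c] is constant. *)
Lemma alt_sum_closed (m K : nat) (i : 'I_m.+1) (h : 'I_m -> vertex m -> int)
    (d : vertex m -> int) :
  (forall v : vertex m, v i = 0%N \/ v i = K.+1 -> d v = 0) ->
  (forall t (v : vertex m), (v (lift i t) = 0%N -> h t v = 0) /\
               (v (lift i t) = K.+1 -> h t v = 1)) ->
  alt_sum K (fun v => d (v i.+1) * gap_prod h i v) =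
  alt_sum K (fun v => d (v i) * gap_prod h i v).
Proof.
move=> d0 hb.
have i_m : (i <= m)%N by rewrite -ltnS.
have E0 := @alt_sum_gap m K h d 0 i.+1 i i_m (ltnSn _).
have E1 := @alt_sum_gap m K h d i i (m - i) _ _.
rewrite add0n in E0; rewrite subnKC // in E1; move/(_ (leqnn _)) in E1.
rewrite leqnn /= in E1; move/(_ isT) in E1.
have bdry_vanish (v : nat -> vertex m) c b k q : (b = 0%N \/ b = K.+1) ->
    v q c = b -> (forall t : 'I_m, v (bump k t).+1 c = b /\ v (bump k t) c = b) ->
    d (v q) * gap_prod h k v = 0.
  move=> b0 vq vb; case: (unliftP i c) => [t|] cE.
    rewrite /gap_prod (bigD1 t) //=.
    have [] := vb t; have [] := hb t (v (bump k t)); have [] := hb t (v (bump k t).+1).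
    rewrite -cE => A B C D E F.
    suff -> : h t (v (bump k t).+1) = h t (v (bump k t)) by rewrite subrr mul0r mulr0.
    by case: b0 => b0; [rewrite A ?C | rewrite B ?D]; rewrite -?b0.
  by rewrite d0 ?mul0r // -cE vq.
rewrite E0.
rewrite (@alt_sum_rotate m K _ (fun v => d (v i) * gap_prod h m v)); first last.
- move=> v c vc; apply: (bdry_vanish v c 0%N); [by left | exact: vc |].
  by move=> t; have tm := ltn_ord t; split; apply: vc; rewrite /bump; lia.
- move=> v c vc; apply: (bdry_vanish v c K.+1); [by right | exact: vc |].
  by move=> t; rewrite /bump /= add1n; have tm := ltn_ord t; split; apply: vc; lia.
- move=> v w vw; rewrite vw //; congr (_ * _); apply: eq_bigr => t _.
  have tm := ltn_ord t.
  have -> : bump m t = t by rewrite /bump; lia.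
  by rewrite /bump /= add1n !vw //; lia.
rewrite E1 !mulrA -!exprD (_ : i + m + (m - i) = m + m)%N; last by lia.
by rewrite addnn -signr_odd odd_double mul1r.
Qed.

(** Splitting the increment of [e i - e' i] along step [i] into its two end values
    gives the two sides of [alt_sum_closed]. *)
Lemma alt_sum_bdry1 (m K : nat) (i : 'I_m.+1)
    (e e' : 'I_m.+1 -> vertex m -> int) :
  bit_bdry K e -> bit_bdry K e' -> (forall j, j != i -> e j = e' j) ->
  alt_sum K (coboundary_prod e) = alt_sum K (coboundary_prod e').
Proof.
move=> eb e'b ee'; apply/eqP; rewrite -subr_eq0 -alt_sumB; apply/eqP.
pose h t := e (lift i t); pose d v := e i v - e' i v.
rewrite (_ : alt_sum K _ = alt_sum K (fun v => d (v i.+1) * gap_prod h i v) -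
    alt_sum K (fun v => d (v i) * gap_prod h i v)); last first.
  rewrite -alt_sumB; apply: eq_alt_sum => x p.
  rewrite /coboundary_prod (bigD1_ord i) //= [X in _ - X = _](bigD1_ord i) //=.
  rewrite [X in _ - _ * X](_ : _ = gap_prod h i (chain x p)); last first.
    by apply: eq_bigr => t _; rewrite -ee' // eq_sym neq_lift.
  by rewrite -/(gap_prod h i (chain x p)) /d; ring.
rewrite alt_sum_closed ?subrr // => v.
rewrite /d; have [A B] := eb i v; have [C D] := e'b i v.
by case=> vi; [rewrite A ?C | rewrite B ?D]; rewrite ?subrr.
Qed.

Lemma alt_sum_bdry (m K : nat) (e e' : 'I_m.+1 -> vertex m -> int) :
  bit_bdry K e -> bit_bdry K e' ->
  alt_sum K (coboundary_prod e) = alt_sum K (coboundary_prod e').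
Proof.
move=> eb e'b.
pose f s (j : 'I_m.+1) := if (j < s)%N then e' j else e j.
have fb s : bit_bdry K (f s).
  by move=> j; rewrite /f; case: ifP => _; [exact: e'b | exact: eb].
have step s : (s <= m.+1)%N ->
    alt_sum K (coboundary_prod e) = alt_sum K (coboundary_prod (f s)).
  elim: s => [//|s IH] sm; rewrite IH 1?ltnW //.
  apply: (alt_sum_bdry1 (i := Ordinal sm)) => // j; rewrite -val_eqE /= => js.
  by rewrite /f ltnS (leq_eqVlt j) (negPf js).
rewrite (step m.+1) //; apply: eq_alt_sum => x p; apply: eq_bigr => j _.
by rewrite /f ltn_ord.
Qed.

Definition std_bits (m : nat) (j : 'I_m.+1) (v : vertex m) : int :=
  (0 < v j)%N%:R.

(** The bit [0 < v j] changes at step [j] only if [x j = 0] and [p j = j], so the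
    only nonzero product is that of the first cell with the identity. *)
Lemma alt_sum_std (m K : nat) :
  alt_sum K (coboundary_prod (@std_bits m)) = 1.
Proof.
have termE x p : coboundary_prod (@std_bits m) (@chain m K x p) =
    ((x == [ffun=> ord0]) && (p == 1%g))%:R.
  have [|] := boolP (_ && _).
    case/andP => /eqP-> /eqP->; apply: big1 => j _.
    by rewrite /std_bits !ffunE perm1 ltnSn ltnn.
  move=> ne; apply/eqP; rewrite prodf_seq_eq0; apply: contraNT ne => /hasPn ne.
  have {}ne j : val (x j) = 0%N /\ val (p j) = j.
    have := ne j (mem_index_enum _); rewrite /= /std_bits !ffunE.
    by rewrite /=; move: (x j) (p j) => [a _] [b _] /=; lia.
  apply/andP; split; apply/eqP.
    by apply/ffunP => j; apply/val_inj; rewrite ffunE; case: (ne j).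
  by apply/permP => j; apply/val_inj; rewrite perm1; case: (ne j).
rewrite /alt_sum (bigD1 1%g) //= odd_perm1 mul1r (bigD1 [ffun=> ord0]) //=.
rewrite termE !eqxx !big1 ?addr0 // => [p|x] ne.
  by rewrite big1 ?mulr0 // => x _; rewrite termE (negPf ne) andbF.
by rewrite termE (negPf ne).
Qed.

(** A cell exists in which all the bits change: otherwise every product in the
    alternating sum would be zero, while the sum is that of the standard bits,
    namely [1]. *)
Lemma discrete_miranda (m K : nat) (e : 'I_m.+1 -> vertex m -> bool) :
  (forall j (v : vertex m), v j = 0%N -> e j v = false) ->
  (forall j (v : vertex m), v j = K.+1 -> e j v = true) ->
  exists (x : {ffun 'I_m.+1 -> 'I_K.+1}) (p : 'S_m.+1),
    forall j : 'I_m.+1, e j (chain x p j.+1) != e j (chain x p j).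
Proof.
move=> e0 e1; pose E j v : int := (e j v)%:R.
have Eb : bit_bdry K E.
  by move=> j v; split=> vj; rewrite /E; [rewrite e0 | rewrite e1].
have sb : bit_bdry K (@std_bits m).
  by move=> j v; split=> vj; rewrite /std_bits vj.
case: (pickP (fun xp : {ffun 'I_m.+1 -> 'I_K.+1} * 'S_m.+1 =>
    coboundary_prod E (chain xp.1 xp.2) != 0)) => [[x p] /= | E0].
  move=> /prodf_neq0 ne; exists x, p => j; apply: contraNneq (ne j isT).
  by rewrite /E => ->; rewrite subrr.
have := alt_sum_bdry Eb sb; rewrite alt_sum_std /alt_sum big1 // => p _.
rewrite big1 ?mulr0 // => x _.
by apply/eqP; have /negbFE := E0 (x, p).
Qed.

(** * Maps on a box *)

Lemma continuous_row (R : realType) (T : topologicalType) (n : nat)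
    (g : T -> 'rV[R]_n) :
  (forall i, continuous (fun x => g x ord0 i)) -> continuous g.
Proof.
move=> gc x A [P Pg PA].
have : \forall y \near x, forall i, P ord0 i (g y ord0 i).
  by apply: filter_forall => i; exact: gc (Pg ord0 i).
apply: filterS => y Py; apply: PA => i j; rewrite ord1; exact: Py.
Qed.

Definition clamp (R : realType) (n : nat) (a b x : 'rV[R]_n) : 'rV[R]_n :=
  \row_i Num.max (a ord0 i) (Num.min (x ord0 i) (b ord0 i)).

Lemma clamp_box (R : realType) (n : nat) (a b x : 'rV[R]_n) :
  (forall i, a ord0 i <= b ord0 i) -> box a b (clamp a b x).
Proof. by move=> ab i; rewrite mxE le_max lexx ge_max ab ge_min lexx orbT. Qed.

Lemma clamp_id (R : realType) (n : nat) (a b x : 'rV[R]_n) :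
  box a b x -> clamp a b x = x.
Proof.
move=> xab; apply/rowP => i; rewrite mxE; case/andP: (xab i) => ax xb.
by rewrite min_l // max_r.
Qed.

Lemma continuous_clamp (R : realType) (n : nat) (a b : 'rV[R]_n) :
  continuous (clamp a b).
Proof.
apply: continuous_row => i; rewrite /clamp.
under eq_fun do rewrite mxE.
apply: (@max_fun_continuous _ _ R (cst (a ord0 i))); first exact: cst_continuous.
apply: min_fun_continuous; last exact: cst_continuous.
exact: coord_continuous.
Qed.

(** Retracting onto the box turns continuity within the box into continuity
    everywhere. *)
Lemma continuous_comp_clamp (R : realType) (n : nat) (T : topologicalType)
    (a b : 'rV[R]_n) (f : 'rV[R]_n -> T) :
  (forall i, a ord0 i <= b ord0 i) ->
  {within box a b, continuous f} -> continuous (f \o clamp a b).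
Proof.
move=> ab /subspace_continuousP fc x A fA.
have /(@continuous_clamp R n a b x) := fc _ (clamp_box x ab) _ fA.
apply: (@filterS _ (nbhs x)) => y; apply; exact: clamp_box.
Qed.

(** The intermediate value theorem along the segment from [x] to [y]. *)
Lemma pos_of_neq0_segment (R : realType) (n : nat) (g : 'rV[R]_n -> R)
    (x y : 'rV[R]_n) : continuous g ->
  (forall t, 0 <= t <= 1 -> g (x + t *: (y - x)) != 0) -> 0 < g x * g y.
Proof.
move=> gc g0; rewrite ltNge; apply/negP => gxy.
pose u t := g (x + t *: (y - x)).
have u0 : u 0 = g x by rewrite /u scale0r addr0.
have u1 : u 1 = g y by rewrite /u scale1r addrC subrK.
have uc : continuous u.
  move=> t; pose l (s : R) := x + s *: (y - x).
  have lc : {for t, continuous l}.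
    by apply: cvgD; [exact: cvg_cst | apply: cvgZr_tmp; exact: cvg_id].
  exact: (continuous_comp lc (gc _)).
have [||t] := @IVT R u 0 1 0 ler01.
- exact: continuous_subspaceT.
- rewrite u0 u1 ge_min le_max; have := lerP (g x) 0; have := lerP (g y) 0.
  by case=> ? []; nra.
- by rewrite in_itv /= => /g0 /eqP.
Qed.

(** * From the grid to the box *)

Definition grid_point (R : realType) (m K : nat) (a b : 'rV[R]_m.+1)
    (v : vertex m) : 'rV[R]_m.+1 :=
  \row_i (a ord0 i + (v i)%:R / K.+1%:R * (b ord0 i - a ord0 i)).

Lemma grid_point_box (R : realType) (m K : nat) (a b : 'rV[R]_m.+1)
    (v : vertex m) : (forall i, a ord0 i <= b ord0 i) ->
  (forall i, (v i <= K.+1)%N) -> box a b (grid_point K a b v).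
Proof.
move=> ab vK i; rewrite mxE.
have h0 : 0 <= (v i)%:R / K.+1%:R :> R by rewrite divr_ge0.
have h1 : (v i)%:R / K.+1%:R <= 1 :> R.
  by rewrite ler_pdivrMr ?ltr0n // mul1r ler_nat.
have := ab i; set q := _ / _ in h0 h1 *.
by move=> abi; apply/andP; split; nra.
Qed.

Lemma chain_le (m K : nat) (x : {ffun 'I_m.+1 -> 'I_K.+1}) (p : 'S_m.+1) k i :
  (chain x p k i <= K.+1)%N.
Proof. by rewrite ffunE; have := ltn_ord (x i); lia. Qed.

Lemma grid_point_chain (R : realType) (m K : nat) (a b : 'rV[R]_m.+1)
    (x : {ffun 'I_m.+1 -> 'I_K.+1}) (p : 'S_m.+1) k i :
  a ord0 i <= b ord0 i ->
  `|grid_point K a b (chain x p 0) ord0 i -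
    grid_point K a b (chain x p k) ord0 i| <=
  K.+1%:R^-1 * (b ord0 i - a ord0 i).
Proof.
move=> ab; rewrite !mxE !ffunE ltn0 addn0 natrD.
set s : R := (x i)%:R; set q : R := K.+1%:R^-1; set c := (p i < k)%N.
have -> : a ord0 i + s * q * (b ord0 i - a ord0 i) -
  (a ord0 i + (s + c%:R) * q * (b ord0 i - a ord0 i)) =
  - (c%:R * (q * (b ord0 i - a ord0 i))) by ring.
have h : 0 <= q * (b ord0 i - a ord0 i) by rewrite mulr_ge0 ?subr_ge0 // invr_ge0.
by rewrite normrN; case: c; rewrite ?mul1r ?mul0r ?normr0 // ger0_norm.
Qed.

(** [discrete_miranda] for the bits recording where [g i] is positive, corrected on
    the faces [x_i = a_i] and [x_i = b_i] where [g i] may vanish; the correction is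
    harmless, since the sign of [g i] there is known in the weak sense. *)
Lemma grid_cell_sign_change (R : realType) (m K : nat) (a b : 'rV[R]_m.+1)
    (g : 'I_m.+1 -> 'rV[R]_m.+1 -> R) :
  (forall i, a ord0 i < b ord0 i) ->
  (forall i x, box a b x -> x ord0 i = a ord0 i -> g i x <= 0) ->
  (forall i x, box a b x -> x ord0 i = b ord0 i -> 0 <= g i x) ->
  exists y, box a b y /\ forall i, exists z z' : 'rV[R]_m.+1,
    [/\ g i z <= 0, 0 <= g i z',
        forall j, `|y ord0 j - z ord0 j| <= K.+1%:R^-1 * (b ord0 j - a ord0 j) &
        forall j, `|y ord0 j - z' ord0 j| <= K.+1%:R^-1 * (b ord0 j - a ord0 j)].
Proof.
move=> ab ga gb; have ab' i : a ord0 i <= b ord0 i by exact: ltW.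
pose e i (v : vertex m) := (v i == K.+1) ||
  (v i != 0%N) && (0 < g i (grid_point K a b v)).
have [||x [p xp]] := @discrete_miranda m K e.
- by move=> i v; rewrite /e => ->.
- by move=> i v; rewrite /e => ->; rewrite eqxx.
exists (grid_point K a b (chain x p 0)).
have bx k : box a b (grid_point K a b (chain x p k)).
  by apply: grid_point_box => // i; exact: chain_le.
have eT i k : e i (chain x p k) -> 0 <= g i (grid_point K a b (chain x p k)).
  case/orP => [/eqP vK|/andP[_ /ltW //]]; apply: gb => //.
  by rewrite mxE vK divff ?pnatr_eq0 // mul1r addrC subrK.
have eF i k : ~~ e i (chain x p k) -> g i (grid_point K a b (chain x p k)) <= 0.
  rewrite negb_or negb_and negbK -leNgt => /andP[_ /orP[/eqP v0|//]].
  by apply: ga => //; rewrite mxE v0 !mul0r addr0.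
split=> // i; have := xp i; case E : (e i (chain x p i.+1)); case E' : (e i (chain x p i)) => // _.
- exists (grid_point K a b (chain x p i)), (grid_point K a b (chain x p i.+1)).
  split; [by apply: eF; rewrite E' | exact: eT | |] => j; exact: grid_point_chain.
- exists (grid_point K a b (chain x p i.+1)), (grid_point K a b (chain x p i)).
  split; [by apply: eF; rewrite E | exact: eT | |] => j; exact: grid_point_chain.
Qed.

Lemma compact_box (R : realType) (n : nat) (a b : 'rV[R]_n) : compact (box a b).
Proof.
have -> : box a b = [set v | forall i, `[a ord0 i, b ord0 i]%classic (v ord0 i)].
  by apply/seteqP; split=> v vab i; have := vab i; rewrite /= in_itv.
apply: (@rV_compact R n (fun i => `[a ord0 i, b ord0 i]%classic)) => i.
exact: segment_compact.
Qed.

(** At a cluster point of the cells above, a nonzero value of [g i] would force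
    [g i] to have a constant strict sign on all small enough cells nearby. *)
Lemma signed_miranda (R : realType) (m : nat) (a b : 'rV[R]_m.+1)
    (g : 'I_m.+1 -> 'rV[R]_m.+1 -> R) :
  (forall i, a ord0 i < b ord0 i) -> (forall i, continuous (g i)) ->
  (forall i x, box a b x -> x ord0 i = a ord0 i -> g i x <= 0) ->
  (forall i x, box a b x -> x ord0 i = b ord0 i -> 0 <= g i x) ->
  exists2 x, box a b x & forall i, g i x = 0.
Proof.
move=> ab gc ga gb.
have [y yP] := choice (fun K => @grid_cell_sign_change R m K a b g ab ga gb).
have [x [bx xy]] : (box a b `&` cluster (y @ \oo)) !=set0.
  apply: (compact_box (fmap_proper_filter y _)).
  by exists 0%N => // K _; case: (yP K).
exists x => // i; apply/eqP; apply: contraT => gx0.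
have : \forall z \near x, 0 < g i x * g i z.
  apply: (@cvgr_gt _ _ (nbhs x) _ (fun z => g i x * g i z) (g i x * g i x)); last by rewrite -expr2 exprn_even_gt0.
  by apply: cvgM; [exact: cvg_cst | exact: gc].
case/nbhs_ballP => r /= r0 rg.
have mesh : \forall K \near \oo, forall j,
    K.+1%:R^-1 * (b ord0 j - a ord0 j) < r / 2.
  apply: filter_forall => j.
  have d0 : 0 < b ord0 j - a ord0 j by rewrite subr_gt0.
  have h : 0 < r / 2 / (b ord0 j - a ord0 j) by rewrite !divr_gt0.
  have := near_infty_natSinv_lt (PosNum h).
  by apply: filterS => K /=; rewrite ltr_pdivlMr.
have [_ [[K /= Kmesh <-] xyK]] :
  (y @` [set K | forall j, K.+1%:R^-1 * (b ord0 j - a ord0 j) < r / 2]) `&`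
    ball x (r / 2) !=set0.
  apply: xy; last by apply: nbhsx_ballx; rewrite divr_gt0.
  by apply: filterS mesh => K KP; exists K.
have [_ /(_ i) [z [z' [gz gz' yz yz']]]] := yP K.
have near_pos (w : 'rV[R]_m.+1) : (forall j, `|y K ord0 j - w ord0 j| <=
    K.+1%:R^-1 * (b ord0 j - a ord0 j)) -> 0 < g i x * g i w.
  move=> yw; apply: rg; split=> // i0 j; rewrite ord1.
  apply: (@ball_splitl _ _ (y K ord0 j)) => /=.
    by case: xyK => _ /(_ ord0 j).
  by rewrite -ball_normE /= distrC; exact: le_lt_trans (yw j) (Kmesh j).
have := near_pos z yz; have := near_pos z' yz'.
by have := lerP (g i x) 0; case=> ?; nra.
Qed.

(** * The sign on the faces *)

Lemma set_coord_id (R : realType) (n : nat) (x : 'rV[R]_n) i c :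
  x ord0 i = c -> set_coord x i c = x.
Proof. by move=> <-; apply/rowP => j; rewrite mxE; case: eqP => // ->. Qed.

Lemma set_coord_box (R : realType) (n : nat) (a b x : 'rV[R]_n) i c :
  box a b x -> a ord0 i <= c <= b ord0 i -> box a b (set_coord x i c).
Proof. by move=> xab ci j; rewrite mxE; case: eqP => [->|]. Qed.

Lemma box_segment (R : realType) (n : nat) (a b x y : 'rV[R]_n) t :
  box a b x -> box a b y -> 0 <= t <= 1 -> box a b (x + t *: (y - x)).
Proof.
move=> xab yab /andP[t0 t1] j; have := xab j; have := yab j; rewrite !mxE.
move: (x ord0 j) (y ord0 j) => r s /andP[? ?] /andP[? ?].
by apply/andP; split; nra.
Qed.

Theorem mainTheorem1 (R : realType) (n : nat) (hn : (1 <= n)%N)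
    (a b : 'rV[R]_n) (hab : forall i : 'I_n, a ord0 i < b ord0 i)
    (f : 'rV[R]_n -> 'rV[R]_n) (hf : {within box a b, continuous f})
    (hsign : forall (i : 'I_n) (x : 'rV[R]_n),
       (forall j : 'I_n, j != i -> a ord0 j <= x ord0 j <= b ord0 j) ->
       f (set_coord x i (a ord0 i)) ord0 i *
         f (set_coord x i (b ord0 i)) ord0 i < 0) :
  exists2 x : 'rV[R]_n, box a b x & f x = 0.
Proof.
case: n hn a b hab f hf hsign => // m _ a b hab f hf hsign.
have ab i : a ord0 i <= b ord0 i by exact: ltW.
pose F := f \o clamp a b.
have Fc : continuous F := continuous_comp_clamp ab hf.
have Fc_i i : continuous (fun x => F x ord0 i).
  move=> x; exact: (continuous_comp (Fc x) (@coord_continuous R 1 m.+1 ord0 i (F x))).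
have Ff x : box a b x -> F x = f x by move=> xab; rewrite /F /= clamp_id.
have Fsign x i : box a b x ->
    F (set_coord x i (a ord0 i)) ord0 i * F (set_coord x i (b ord0 i)) ord0 i < 0.
  move=> xab; rewrite !Ff; first by apply: hsign => j _; exact: xab.
    by apply: set_coord_box; rewrite // ab lexx.
  by apply: set_coord_box; rewrite // ab lexx.
have boxa : box a b a by move=> i; rewrite lexx ab.
(* The factor is a value of [f_i] on the face [x_i = b_i]: it makes [g i] positive
   on this face, whatever the sign of [f_i] there. *)
pose g i x := F (set_coord a i (b ord0 i)) ord0 i * F x ord0 i.
have g_pos i x : box a b x -> x ord0 i = b ord0 i -> 0 < g i x.
  move=> xab xi; apply: (pos_of_neq0_segment (Fc_i i)) => t t01.
  set z := _ + _.
  have zi : z ord0 i = b ord0 i by rewrite !mxE eqxx xi subrr mulr0 addr0.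
  have zab : box a b z.
    by apply: box_segment => //; apply: set_coord_box; rewrite // ab lexx.
  have := Fsign z i zab; rewrite [X in _ * F X _ _](@set_coord_id _ _ z) // => h.
  by apply: contraTneq h => ->; rewrite mulr0 ltxx.
have g_neg i x : box a b x -> x ord0 i = a ord0 i -> g i x < 0.
  move=> xab xi; have := Fsign x i xab; rewrite [X in F X _ _ * _](@set_coord_id _ _ x) // => h.
  have : 0 < g i (set_coord x i (b ord0 i)).
    apply: g_pos; last by rewrite mxE eqxx.
    by apply: set_coord_box; rewrite // ab lexx.
  rewrite /g; move: h.
  move: (F x ord0 i) (F (set_coord x _ _) ord0 i) (F _ ord0 i) => p r q pr qr.
  by have [r0|r0] := lerP r 0; nra.
have [i|i x xab xi|i x xab xi|x xab gx] := @signed_miranda R m a b g hab.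
- by move=> x; apply: (@continuousM _ _ (cst _) _ x _ (Fc_i i x)); exact: cst_continuous.
- exact/ltW/g_neg.
- exact/ltW/g_pos.
exists x => //; apply/rowP => i; rewrite mxE -Ff //.
have /eqP := gx i; rewrite mulf_eq0 => /orP[/eqP F0|/eqP //].
have := Fsign a i boxa; rewrite F0 mulr0 ltxx //.
Qed.
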